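(* Let $d\ge 1$ be an integer, $b$ a prime and $v\ge 0$ an integer. There exists a constant $C_{d,b,v}>0$ such that for every positive integer $n$ and every order $2$ digital $(v,n,d)$-net $\mathcal{P}_n^b$ over $\mathbb{F}_b$ we have \[ \left\|D_{\mathcal{P}_n^b}\,|\,L_2([0,1)^d)\right\|\leq C_{d,b,v}\,\frac{n^{(d-1)/2}}{b^n}. \]
   Context: Discrepancy function: for a finite family $\mathcal{P}$ of $N$ points in $[0,1)^d$ (points counted with multiplicity), $D_{\mathcal{P}}(x)=\frac1N\sum_{z\in\mathcal{P}}\chi_{[0,x)}(z)-x_1\cdots x_d$ for $x=(x_1,\ldots,x_d)\in[0,1)^d$, where $\chi_{[0,x)}$ is the characteristic function of $[0,x)=[0,x_1)\times\cdots\times[0,x_d)$. Digital nets: let $b$ be prime and let $\mathbb{F}_b$ be the field with $b$ elements, identified with $\{0,1,\ldots,b-1\}$ with arithmetic modulo $b$. For $s,n\in\mathbb{N}$ with $s\ge n$ let $C_1,\ldots,C_d$ be $s\times n$ matrices over $\mathbb{F}_b$. For $\nu\in\{0,\ldots,b^n-1\}$ with $b$-adic expansion $\nu=\nu_0+\nu_1b+\cdots+\nu_{n-1}b^{n-1}$ put $\bar\nu=(\nu_0,\ldots,\nu_{n-1})^\top\in\mathbb{F}_b^n$, $C_i\bar\nu=(x_{i,\nu,1},\ldots,x_{i,\nu,s})^\top\in\mathbb{F}_b^s$, $x_{i,\nu}=x_{i,\nu,1}b^{-1}+\cdots+x_{i,\nu,s}b^{-s}\in[0,1)$ and $x_\nu=(x_{1,\nu},\ldots,x_{d,\nu})$.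 The family $\mathcal{P}_n^b=\{x_0,\ldots,x_{b^n-1}\}$ of $N=b^n$ points (with multiplicity) is called a digital net over $\mathbb{F}_b$. Order $\sigma$ digital $(v,n,d)$-net: let $\sigma\in\mathbb{N}$, $s\ge\sigma n$, and let $0\le v\le\sigma n$ be an integer. Let $c_{i,1},\ldots,c_{i,s}\in\mathbb{F}_b^n$ be the rows of $C_i$. If for all choices of $0\le\eta_i\le s$ and indices $1\le\lambda_{i,\eta_i}<\cdots<\lambda_{i,1}\le s$ ($1\le i\le d$) with \[\sum_{i=1}^d\left(\lambda_{i,1}+\cdots+\lambda_{i,\min(\eta_i,\sigma)}\right)\le\sigma n-v\] the vectors $c_{1,\lambda_{1,1}},\ldots,c_{1,\lambda_{1,\eta_1}},\ldots,c_{d,\lambda_{d,1}},\ldots,c_{d,\lambda_{d,\eta_d}}$ are linearly independent over $\mathbb{F}_b$, then $\mathcal{P}_n^b$ is called an order $\sigma$ digital $(v,n,d)$-net over $\mathbb{F}_b$. *)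

(* Defs.v *)
From HB Require Import structures.
From mathcomp Require Import all_boot all_order all_algebra.
From mathcomp Require Import all_classical all_reals all_analysis.

Set Implicit Arguments.
Unset Strict Implicit.
Unset Printing Implicit Defensive.
Import Order.TTheory GRing.Theory Num.Theory.
Import numFieldNormedType.Exports.

Local Open Scope classical_set_scope.
Local Open Scope ring_scope.

Notation euclidean R d := (d.-tuple (measurableTypeR R)).

(* Lebesgue measure on R^(d+1), given Lebesgue measure [m] on R^d.  It has to be
   a sigma-finite measure again, so that the product can be iterated. *)
Section lebesgue_cons.
Context {R : realType} {d : nat}.
Variable m : {sigma_finite_measure set (euclidean R d) -> \bar R}.
Local Open Scope ereal_scope.

Definition cons_pair (x : measurableTypeR R * euclidean R d) :
    euclidean R d.+1 :=
  [tuple of x.1 :: x.2].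

Lemma measurable_cons_pair : measurable_fun [set: _] cons_pair.
Proof. exact: measurable_cons. Qed.

Definition lebesgue_cons : set (euclidean R d.+1) -> \bar R :=
  pushforward (lebesgue_measure \x m) cons_pair.

HB.instance Definition _ := Measure.copy lebesgue_cons
  (measure_function_pushforward__canonical__measure_function_Measure
     (lebesgue_measure \x m) measurable_cons_pair).

Lemma lebesgue_consE (A : set (measurableTypeR R)) (B : set (euclidean R d)) :
    measurable A -> measurable B ->
  lebesgue_cons [set y | A (thead y) /\ B [tuple of behead y]] =
  lebesgue_measure A * m B.
Proof.
move=> mA mB; rewrite -product_measure1E// /lebesgue_cons /pushforward.
congr (product_measure1 _ _ _); apply/seteqP; split=> -[a x] /=.
  by move=> [Aa]; rewrite (_ : [tuple of _] = x)//; exact/val_inj.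
by move=> [Aa Bx]; split=> //; rewrite (_ : [tuple of _] = x)//; exact/val_inj.
Qed.

Lemma lebesgue_cons_sigma_finite : sigma_finite setT lebesgue_cons.
Proof.
have /sigma_finiteP[F [TF ndF Foo]] :=
  sigma_finiteT (@lebesgue_measure R : {sigma_finite_measure set _ -> \bar R}).
have /sigma_finiteP[G [TG ndG Goo]] := sigma_finiteT m.
exists (fun i => [set y | F i (thead y) /\ G i [tuple of behead y]]).
  apply/seteqP; split=> // y _.
  have [i _ Fi] : (\bigcup_i F i) (thead y) by rewrite -TF.
  have [j _ Gj] : (\bigcup_i G i) [tuple of behead y] by rewrite -TG.
  exists (maxn i j) => //; split.
  - by move: Fi; exact/subsetPset/ndF/leq_maxl.
  - by move: Gj; exact/subsetPset/ndG/leq_maxr.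
move=> i; have [mF Fy] := Foo i; have [mG Gy] := Goo i; split.
  apply: measurableI.
    rewrite -[X in measurable X]setTI; exact: (measurable_tnth ord0).
  by rewrite -[X in measurable X]setTI; exact: measurable_behead.
by rewrite lebesgue_consE// lte_mul_pinfty// ge0_fin_numE.
Qed.

HB.instance Definition _ := Measure_isSigmaFinite.Build _ _ _
  lebesgue_cons lebesgue_cons_sigma_finite.

End lebesgue_cons.

Fixpoint lebesgue_euclidean (R : realType) (d : nat) :
    {sigma_finite_measure set (euclidean R d) -> \bar R} :=
  if d is d'.+1 then lebesgue_cons (lebesgue_euclidean R d')
  else dirac ([tuple] : euclidean R 0).

Lemma lebesgue_euclidean_box (R : realType) (d : nat)
    (A : 'I_d -> set (measurableTypeR R)) :
    (forall i, measurable (A i)) ->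
  lebesgue_euclidean R d [set x | forall i, A i (tnth x i)] =
  (\prod_(i < d) lebesgue_measure (A i))%E.
Proof.
elim: d A => [|d IHd] A mA.
  rewrite big_ord0 /= diracE (_ : _ \in _)// inE /= => -[] //.
rewrite big_ord_recl -IHd//= -lebesgue_consE//.
  congr lebesgue_cons; apply/seteqP; split=> y /= Ay.
    split=> [|i]; first exact: Ay.
    by have := Ay (lift ord0 i); rewrite {1}(tuple_eta y) tnthS.
  move: Ay => [y0 Ay] i; case: (unliftP ord0 i) => [j ->|->//].
  by rewrite (tuple_eta y) tnthS; exact: Ay.
rewrite (_ : mkset _ = \bigcap_(i in [set: 'I_d])
  ((fun x : euclidean R d => tnth x i) @^-1` A (lift ord0 i))).
  apply: fin_bigcap_measurable => // i _.
  by rewrite -[X in measurable X]setTI; exact: measurable_tnth.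
by apply/seteqP; split=> x /= Ax i; [move=> _|]; exact: Ax.
Qed.

(* [0, x) = [0, x_1) x ... x [0, x_d) *)
Definition anchored_box (R : realType) (d : nat) (x : euclidean R d) :
    set (euclidean R d) :=
  [set z | forall i, 0 <= tnth z i < tnth x i].

Definition unit_cube (R : realType) (d : nat) : set (euclidean R d) :=
  [set x | forall i, 0 <= tnth x i < 1].

Definition discrepancy (R : realType) (d N : nat)
    (P : 'I_N -> euclidean R d) (x : euclidean R d) : R :=
  N%:R^-1 * (\sum_(i < N) \1_(anchored_box x) (P i)) - \prod_(i < d) tnth x i.

(* The library's L2-norm is over the whole space, hence the extension by 0. *)
Definition L2norm_cube (R : realType) (d : nat) (f : euclidean R d -> R) :
    \bar R :=
  'N[lebesgue_euclidean R d]_(2%:E)[(EFin \o f) \_ (@unit_cube R d)].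

Definition digit_vector (b n : nat) (nu : nat) : 'cV['F_b]_n :=
  \col_(j < n) ((nu %/ b ^ j) %% b)%N%:R.

(* Elements of 'F_b are ordinals: for b prime, [c : 'F_b] coerces to its
   representative in {0, ..., b - 1}. *)
Definition digital_net (R : realType) (b d s n : nat)
    (C : 'I_d -> 'M['F_b]_(s, n)) (nu : 'I_(b ^ n)) : euclidean R d :=
  [tuple \sum_(k < s)
           ((C i *m digit_vector b n nu) k ord0 : nat)%:R / b%:R ^+ k.+1
   | i < d].

(* [lam i] is the decreasing list of the selected row indices of [C i]: eta_i is
   its size, and the ordinal k : 'I_s stands for the 1-based index k.+1. *)
Definition order_digital_net (sigma v b d s n : nat)
    (C : 'I_d -> 'M['F_b]_(s, n)) : Prop :=
  [/\ (sigma * n <= s)%N, (v <= sigma * n)%N &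
    forall lam : 'I_d -> seq 'I_s,
      (forall i, sorted (fun k l : 'I_s => (l < k)%N) (lam i)) ->
      (\sum_(i < d) \sum_(k <- take sigma (lam i)) k.+1 <= sigma * n - v)%N ->
      free (flatten [seq [seq row k (C i) | k <- lam i] | i <- enum 'I_d])].

(* Main.v *)
Require Import Defs.
From mathcomp Require Import all_boot all_order all_algebra.
From mathcomp Require Import all_classical all_reals all_analysis.
From mathcomp Require Import measurable_realfun.
From mathcomp Require Import zify ring lra.

Set Implicit Arguments.
Unset Strict Implicit.
Unset Printing Implicit Defensive.
Import Order.TTheory GRing.Theory Num.Theory.
Import numFieldNormedType.Exports.

Local Open Scope classical_set_scope.
Local Open Scope ring_scope.

(** The discrepancy is, up to [d b^-s], constant on the cells of side [b^-s].
    On the cell indexed by a family [m] of [d] words of [s] digits it equals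
    [D(m)], the mean over the net minus the mean over all families of words [z]
    of [prod_i 1_(z_i <= m_i)].  Each factor is a sum of martingale differences
    [haar z_i m_i j], [0 <= j <= s], in the variable [m_i], so that [D] splits
    into orthogonal components [D_j] with [j] in [{0, ..., s}^d].  In the
    variable [z_i], the factor [haar z_i m_i j] is a sum over [k] of [b^-k] times
    a bounded function of the first [j] digits and the digit number [j + k].
    An order 2 net equidistributes all these digits as soon as
    [sum_i (2 j_i + k_i) <= 2n - v]; hence only the [k] with
    [|k| > 2n - v - 2|j|] contribute to [D_j], and the mean of [D_j^2] is at most
    [c b^(-2n) (8/9)^| |j| - n |].  Summing over [j] costs a factor [n^(d-1)],
    the number of [j] with [|j| = n] being of that order. *)

(** * Geometric sums *)

Lemma sum_leqn_le N n : (\sum_(t < N) (t <= n) <= n.+1)%N.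
Proof.
rewrite -(big_mkord xpredT (fun t => (t <= n)%N : nat)).
apply: (@leq_trans (\sum_(0 <= t < n.+1 + N) (t <= n)%N)).
  by rewrite [leqRHS](big_cat_nat (n := N)) ?leq_addl //= leq_addr.
rewrite (big_cat_nat (n := n.+1)) ?leq_addr //= [X in (_ + X)%N]big_nat.
rewrite [X in (_ + X)%N]big1 ?addn0; last by move=> t /andP[nt _]; rewrite leqNgt nt.
apply: (@leq_trans (\sum_(0 <= t < n.+1) 1)); first exact: leq_sum (fun _ _ => leq_b1 _).
by rewrite sum_nat_const_nat subn0 muln1.
Qed.

(** Peels off the coordinate 0, for inductions on the dimension. *)
Lemma sum_ffunS (V : nmodType) d (T : finType) (F : {ffun 'I_d.+1 -> T} -> V) :
  \sum_f F f = \sum_t \sum_(f : {ffun 'I_d -> T})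
    F [ffun i => if unlift ord0 i is Some i' then f i' else t].
Proof.
rewrite pair_big /=.
rewrite (reindex (fun p : T * {ffun 'I_d -> T} =>
  [ffun i => if unlift ord0 i is Some i' then p.2 i' else p.1])) //.
exists (fun f : {ffun 'I_d.+1 -> T} => (f ord0, [ffun i : 'I_d => f (lift ord0 i)]))
  => [[t f]|f] _ /=.
  congr pair; first by rewrite ffunE unlift_none.
  by apply/ffunP => i; rewrite !ffunE liftK.
by apply/ffunP => i; rewrite ffunE; case: unliftP => [j ->|->]; rewrite ?ffunE.
Qed.

Section GeometricSums.
Variables (R : realFieldType) (x : R).
Hypotheses (x_ge0 : 0 <= x) (x_lt1 : x < 1).

Lemma sum_geometric_le N : \sum_(i < N) x ^+ i <= (1 - x)^-1.
Proof.
have x1 : 0 < 1 - x by rewrite subr_gt0.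
have := subrX1 x N => E; rewrite -[leRHS]mul1r ler_pdivlMr //.
have -> : (\sum_(i < N) x ^+ i) * (1 - x) = 1 - x ^+ N.
  by rewrite -[RHS]opprB E; ring.
by rewrite lerBlDr lerDl exprn_ge0.
Qed.

(* The truncated differences add up to [t - n + (n - t) = |t - n|]. *)
Lemma sum_geometric_dist_le N n :
  \sum_(t < N) x ^+ ((t - n) + (n - t)) <= 2 * (1 - x)^-1.
Proof.
apply: (@le_trans _ _ (\sum_(0 <= t < n + N) x ^+ ((t - n) + (n - t)))).
  rewrite (big_cat_nat (n := N)) ?leq_addl //= big_mkord lerDl.
  by apply: sumr_ge0 => i _; rewrite exprn_ge0.
rewrite (big_cat_nat (n := n)) ?leq_addr //= mulr_natl mulr2n lerD //.
  rewrite big_nat_rev big_mkord add0n; apply: le_trans (sum_geometric_le n.+1).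
  rewrite big_ord_recl -[leLHS]add0r lerD ?expr0 // le_eqVlt; apply/orP; left.
  by apply/eqP/eq_bigr => i _; congr (_ ^+ _); rewrite /= /bump; have := ltn_ord i; lia.
rewrite -{1}[n]add0n big_addn addKn big_mkord.
apply: le_trans (sum_geometric_le N); apply: ler_sum => i _.
by rewrite addnK [X in (_ + X)%N](_ : _ = 0%N) ?addn0 //; lia.
Qed.

Lemma sum_ffun_geometric_le d N :
  \sum_(f : {ffun 'I_d -> 'I_N}) x ^+ (\sum_i f i) <= (1 - x)^-1 ^+ d.
Proof.
under eq_bigr do rewrite expr_sum.
rewrite -(bigA_distr_bigA (fun (i : 'I_d) (t : 'I_N) => x ^+ t)) prodr_const card_ord.
apply: lerXn2r; rewrite ?nnegrE ?invr_ge0 ?subr_ge0 ?sum_geometric_le ?(ltW x_lt1) //.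
by apply: sumr_ge0 => t _; rewrite exprn_ge0.
Qed.

(** About [n ^ d] families have sum [n], and the weight decays away from that level. Induction on
    [d], with [t] the value at the coordinate 0: the at most [n.+1] values [t <= n] fall under the
    induction hypothesis at [n - t]; for [t > n] the weight is [x ^+ (t - n)] times that of the
    other coordinates, whose sum is bounded. *)
Lemma sum_ffun_geometric_dist_le d : exists2 c : R, 0 <= c &
  forall N n, \sum_(f : {ffun 'I_d.+1 -> 'I_N})
    x ^+ ((\sum_i f i - n) + (n - \sum_i f i)) <= c * n.+1%:R ^+ d.
Proof.
have q0 : 0 <= (1 - x)^-1 by rewrite invr_ge0 subr_ge0 ltW.
have split0 d' N (t : 'I_N) (f : {ffun 'I_d' -> 'I_N}) :
    (\sum_i [ffun i => if unlift ord0 i is Some i' then f i' else t] i = t + \sum_i f i)%N.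
  rewrite big_ord_recl ffunE unlift_none; congr addn; apply: eq_bigr => i _.
  by rewrite ffunE liftK.
elim: d => [|d [c c0 IH]].
  exists (2 * (1 - x)^-1) => [|N n]; first by rewrite mulr_ge0.
  rewrite expr0 mulr1 sum_ffunS; apply: le_trans (sum_geometric_dist_le N n).
  apply: ler_sum => t _; under eq_bigr do rewrite split0 big_ord0 addn0.
  by rewrite sumr_const card_ffun !card_ord expn0 mulr1n.
exists (c + 2 * (1 - x)^-1 * (1 - x)^-1 ^+ d.+1) => [|N n].
  by rewrite addr_ge0 // !mulr_ge0 // exprn_ge0.
rewrite sum_ffunS; under eq_bigr do under eq_bigr do rewrite split0.
(* The summands cover the cases [t <= n] and [n < t]. The second is kept for all [t], so that
   [sum_geometric_dist_le] applies; hence the 2 in the constant. *)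
pose G (t : nat) := (t <= n)%:R * (c * n.+1%:R ^+ d) +
  x ^+ ((t - n) + (n - t)) * (1 - x)^-1 ^+ d.+1.
apply: (@le_trans _ _ (\sum_(t < N) G t)).
  apply: ler_sum => t _; rewrite /G; have [tn|nt] := leqP t n.
    rewrite mul1r -[leLHS]addr0 lerD //; last by rewrite mulr_ge0 ?exprn_ge0.
    apply: le_trans (_ : c * (n - t).+1%:R ^+ d <= _); last first.
      by rewrite ler_wpM2l // lerXn2r ?nnegrE // ler_nat; lia.
    apply: le_trans (IH N (n - t)%N); apply: ler_sum => f _.
    rewrite le_eqVlt; apply/orP; left; apply/eqP; congr (_ ^+ _); lia.
  rewrite mul0r add0r.
  apply: le_trans (_ : _ <= x ^+ ((t - n) + (n - t)) * _)
    (ler_wpM2l _ (sum_ffun_geometric_le d.+1 N)).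
    rewrite mulr_sumr; apply: ler_sum => f _.
    rewrite -exprD le_eqVlt; apply/orP; left; apply/eqP; congr (_ ^+ _); lia.
  by rewrite exprn_ge0.
rewrite /G big_split /= -!mulr_suml mulrDl lerD //.
  rewrite exprS [leRHS]mulrCA ler_wpM2r ?mulr_ge0 ?exprn_ge0 //.
  rewrite -natr_sum ler_nat.
  exact: sum_leqn_le.
rewrite -[leLHS]mulr1 ler_pM ?ler_wpM2r ?sum_geometric_dist_le ?exprn_ge0 //.
  by rewrite mulr_ge0 ?exprn_ge0 ?sumr_ge0 // => *; rewrite exprn_ge0.
by rewrite exprn_ege1 // (ler_nat _ 1).
Qed.

End GeometricSums.

(** * Words and the one-dimensional Haar decomposition *)

Section Words.
Variables (b s : nat).
Hypothesis b_pr : prime b.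
Local Notation word := 'cV['F_b]_s.
Implicit Types (z m : word) (j k : nat).

(* Digits are numbered from 0 and vanish beyond the length [s] of the word. *)
Definition digit z k : nat := oapp (fun i => nat_of_ord (z i ord0)) 0%N (insub k).

Lemma digit_ord z (i : 'I_s) : digit z i = z i ord0.
Proof. by rewrite /digit insubT //= => H; congr (nat_of_ord (z _ _)); exact: val_inj. Qed.

Lemma digit_ge z k : (s <= k)%N -> digit z k = 0%N.
Proof. by move=> sk; rewrite /digit insubN // -leqNgt. Qed.

Lemma ltn_Fp (c : 'F_b) : (c < b)%N.
Proof. by rewrite -[X in (_ < X)%N](Fp_cast b_pr); exact: ltn_ord. Qed.

Lemma digit_lt z k : (digit z k < b)%N.
Proof.
rewrite /digit; case: insubP => [i _ _|_] /=; first exact: ltn_Fp.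
exact: prime_gt0.
Qed.

Lemma sum_Fp (V : nmodType) (h : nat -> V) :
  \sum_(c : 'F_b) h c = \sum_(0 <= i < b) h i.
Proof.
by rewrite -[in RHS](Fp_cast b_pr) big_mkord.
Qed.

Fixpoint prefix_value z j : nat :=
  if j is j'.+1 then (b * prefix_value z j' + digit z j')%N else 0%N.

Lemma prefix_value_lt z j : (prefix_value z j < b ^ j)%N.
Proof.
elim: j => [|j IH] //=; rewrite expnS.
by have := digit_lt z j; nia.
Qed.

Lemma eq_prefix_valueS z m j :
  (prefix_value z j.+1 == prefix_value m j.+1) =
  (prefix_value z j == prefix_value m j) && (digit z j == digit m j).
Proof.
have := digit_lt z j; have := digit_lt m j => /= h1 h2.
apply/eqP/andP => [E|[/eqP-> /eqP->]//].
have E1 : prefix_value z j = prefix_value m j by nia.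
by split; apply/eqP => //; nia.
Qed.

Lemma eq_prefix_value z m j : prefix_value z j = prefix_value m j <->
  forall k, (k < j)%N -> digit z k = digit m k.
Proof.
elim: j => [|j IH]; first by split.
split=> [/eqP|E].
  rewrite eq_prefix_valueS => /andP[/eqP/IH E /eqP e] k.
  by rewrite ltnS leq_eqVlt => /orP[/eqP->//|/E].
apply/eqP; rewrite eq_prefix_valueS E // eqxx andbT; apply/eqP/IH => k kj.
by rewrite E // ltnW.
Qed.

Lemma eq_prefix_value_le z m j k : (k <= j)%N ->
  prefix_value z j = prefix_value m j -> prefix_value z k = prefix_value m k.
Proof.
by move=> kj /eq_prefix_value E; apply/eq_prefix_value => l lk; apply: E; exact: leq_trans kj.
Qed.

Lemma prefix_value_inj : injective (prefix_value^~ s).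
Proof.
move=> z m /eq_prefix_value E; apply/matrixP => i k; rewrite ord1.
by apply: val_inj; rewrite /= -!digit_ord E.
Qed.

Lemma card_word : #|{: word}| = (b ^ s)%N.
Proof. by rewrite card_mx card_Fp // muln1. Qed.

Lemma sum_word (V : nmodType) (h : nat -> V) :
  \sum_z h (prefix_value z s) = \sum_(i < b ^ s) h i.
Proof.
pose f z := Ordinal (prefix_value_lt z s).
have f_inj : injective f by move=> z m [] /prefix_value_inj.
have f_bij : bijective f.
  by apply: inj_card_bij => //; rewrite card_word card_ord.
by rewrite (reindex f) //; exact: onW_bij.
Qed.

Lemma word_of_nat q : (q < b ^ s)%N -> exists z, prefix_value z s = q.
Proof.
move=> qb; pose f z := Ordinal (prefix_value_lt z s).
have f_inj : injective f by move=> z m [] /prefix_value_inj.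
have [g fK gK] : bijective f.
  by apply: inj_card_bij => //; rewrite card_word card_ord.
by exists (g (Ordinal qb)); have /(congr1 val) := gK (Ordinal qb).
Qed.

Lemma digit_shift z (i : 'I_s) (c : 'F_b) k :
  digit (z + c *: delta_mx i ord0) k =
  if k == i :> nat then ((z i ord0 + c)%R : nat) else digit z k.
Proof.
rewrite /digit; case: insubP => [l _ <-|] /=.
  rewrite !mxE eqxx andbT; case: (eqVneq l i) => [->|ne].
    by rewrite eqxx mulr1.
  by rewrite -val_eqE in ne; rewrite (negbTE ne) mulr0 addr0.
by case: eqP => // -> /negP; case; exact: ltn_ord.
Qed.

Lemma prefix_value_shift z (i : 'I_s) (c : 'F_b) j : (j <= i)%N ->
  prefix_value (z + c *: delta_mx i ord0) j = prefix_value z j.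
Proof.
move=> ji; apply/eq_prefix_value => k kj; rewrite digit_shift ifN //.
by rewrite ltn_eqF // (leq_trans kj).
Qed.

(** Each translation of the digit number [i] permutes the words. Averaging over these translations
    isolates one digit without splitting words into digits. *)
Lemma sum_shift (V : nmodType) (G : word -> V) (i : 'I_s) :
  (\sum_z G z) *+ b = \sum_z \sum_(c : 'F_b) G (z + c *: delta_mx i ord0).
Proof.
rewrite exchange_big /= -[X in _ *+ X](card_Fp b_pr) -sumr_const.
apply: eq_bigr => c _.
by rewrite [LHS](reindex_inj (addIr (c *: delta_mx i ord0))).
Qed.

Lemma sum_Fp_shift (V : nmodType) (h : nat -> V) (a : 'F_b) :
  \sum_(c : 'F_b) h (a + c : 'F_b)%R = \sum_(0 <= i < b) h i.
Proof. by rewrite -sum_Fp [RHS](reindex_inj (addrI a)). Qed.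

Variable R : realFieldType.

Lemma sum_nat_eqn (N x : nat) : (x < N)%N ->
  \sum_(0 <= i < N) (x == i)%:R = 1 :> R.
Proof.
move=> xN; rewrite big_mkord (bigD1 (Ordinal xN)) //= eqxx big1 ?addr0 // => i.
by rewrite -val_eqE /= eq_sym => /negbTE ->.
Qed.

Lemma sum_nat_leqn (N x : nat) : (x <= N)%N ->
  \sum_(0 <= i < N) (x <= i)%:R = N%:R - x%:R :> R.
Proof.
move=> xN; rewrite (big_cat_nat (n := x)) //= big_nat_cond big1 ?add0r.
  rewrite big_nat_cond (eq_bigr (fun=> 1)) ?sumr_const_nat; last first.
    by move=> i /andP[/andP[->]].
  by rewrite -big_nat_cond sumr_const_nat natrB.
by move=> i /andP[/andP[_ ix]] _; rewrite leqNgt ix.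
Qed.

Lemma sum_nat_geqn (N x : nat) : (x < N)%N ->
  \sum_(0 <= i < N) (i <= x)%:R = x.+1%:R :> R.
Proof.
move=> xN; rewrite (big_cat_nat (n := x.+1)) //= [X in _ + X]big_nat_cond.
rewrite [X in _ + X]big1 ?addr0; last first.
  by move=> i /andP[/andP[xi _]] _; rewrite leqNgt xi.
rewrite big_nat_cond (eq_bigr (fun=> 1)).
  by rewrite -big_nat_cond sumr_const_nat subn0.
by move=> i /andP[/andP[_]]; rewrite ltnS => ->.
Qed.

Let b_gt0 : 0 < b%:R :> R.
Proof. by rewrite ltr0n prime_gt0. Qed.
Let b_neq0 : b%:R != 0 :> R.
Proof. by rewrite gt_eqF. Qed.

Lemma sum_prefix_value_eq m j : (j <= s)%N ->
  \sum_z (prefix_value z j == prefix_value m j)%:R = b%:R ^+ s / b%:R ^+ j :> R.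
Proof.
elim: j => [|j IH] js.
  rewrite /= (eq_bigr (fun=> 1)) ?sumr_const ?card_word //.
  by rewrite expr0 divr1 natrX.
apply: (mulIf b_neq0); rewrite mulr_natr (sum_shift _ (Ordinal js)).
transitivity (\sum_z (prefix_value z j == prefix_value m j)%:R : R).
  apply: eq_bigr => z _.
  under eq_bigr => c _.
    rewrite eq_prefix_valueS prefix_value_shift // digit_shift eqxx.
    rewrite -mulnb natrM eq_sym [X in _ * (nat_of_bool X)%:R]eq_sym.
    over.
  rewrite -mulr_sumr.
  rewrite (sum_Fp_shift (fun i => (digit m j == i)%:R : R)).
  by rewrite sum_nat_eqn ?mulr1 1?eq_sym // digit_lt.
by rewrite IH ?(ltnW js) // exprS; field; rewrite b_neq0 expf_neq0.
Qed.

Lemma prefix_value_expansion z j :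
  \sum_(k < j) (digit z k)%:R / b%:R ^+ k.+1 = (prefix_value z j)%:R / b%:R ^+ j :> R.
Proof.
elim: j => [|j IH]; first by rewrite big_ord0 mul0r.
rewrite big_ord_recr IH /= natrD natrM exprS.
by field; rewrite b_neq0 expf_neq0.
Qed.

(** The fractional part of [b ^ j] times the point with digits [z]. Digits past the end of the word
    are 0, so the range of the sum can be the same for all [j]. *)
Definition tail_value z j : R := \sum_(k < s) (digit z (j + k))%:R / b%:R ^+ k.+1.

Lemma tail_valueS z j : tail_value z j = ((digit z j)%:R + tail_value z j.+1) / b%:R.
Proof.
have -> : tail_value z j = \sum_(k < s.+1) (digit z (j + k))%:R / b%:R ^+ k.+1.
  by rewrite big_ord_recr /= [digit z (j + s)]digit_ge ?leq_addl // mul0r addr0.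
rewrite big_ord_recl addn0 expr1 mulrDl; congr (_ + _).
rewrite mulr_suml; apply: eq_bigr => k _.
by rewrite /= /bump add1n addSnnS [in LHS]exprS invfM mulrCA [RHS]mulrC.
Qed.

(* With [E z m j] the mean of [1_(z <= m')] over the words [m'] sharing the first
   [j] digits of [m], [haar z m j] is [E z m j - E z m j.-1] (and [E z m 0] for
   [j = 0]); as a function of [z] it is affine in the tail after digit [j]. *)
Definition haar_scale z m j : R :=
  if j is j'.+1 then
    (digit z j' <= digit m j')%:R - 1 + (digit z j')%:R / b%:R
  else 1.

Definition haar_slope z m j : R :=
  if j is j'.+1 then b%:R^-1 - (digit z j' == digit m j')%:R else -1.

Definition haar z m j : R :=
  (prefix_value z j.-1 == prefix_value m j.-1)%:R *
    (haar_scale z m j + haar_slope z m j * tail_value z j).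

Lemma sum_haar z m :
  \sum_(j < s.+1) haar z m j = (prefix_value z s <= prefix_value m s)%:R.
Proof.
(* Closed form, for [j <= s], of the mean of [1_(z <= m')] over the words [m'] sharing the first [j]
   digits of [m]: if the prefixes agree, a proportion [tail_value z j] of these [m'] lies below [z].
   The [haar z m j] are the increments of [E]. *)
pose E j := (prefix_value z j <= prefix_value m j)%:R -
  (prefix_value z j == prefix_value m j)%:R * tail_value z j.
have -> : (prefix_value z s <= prefix_value m s)%:R = E s.
  rewrite /E /tail_value big1 ?mulr0 ?subr0 // => k _.
  by rewrite digit_ge ?leq_addr // mul0r.
suff H n : \sum_(j < n.+1) haar z m j = E n by exact: H.
elim: n => [|j IH].
  by rewrite big_ord_recl big_ord0 /haar /E /= addr0 !mul1r mulN1r.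
rewrite big_ord_recr /= IH /E /haar eq_prefix_valueS tail_valueS.
rewrite /=.
have := digit_lt z j; have := digit_lt m j => h1 h2.
case: (ltngtP (prefix_value z j) (prefix_value m j)) => [lt|gt|->] /=.
- have -> : (b * prefix_value z j + digit z j <=
    b * prefix_value m j + digit m j)%N by nia.
  by rewrite !mul0r addr0.
- have -> : (b * prefix_value z j + digit z j <=
    b * prefix_value m j + digit m j)%N = false by nia.
  by rewrite !mul0r addr0.
- by rewrite leq_add2l; field.
Qed.

(** For [j < k], the factor [haar z m j] does not see the digit number [k] of [m] (counted from 1),
    and [haar z' m k] has mean 0 over that digit. *)
Lemma haar_orthogonal z z' j k : (j <= s)%N -> (k <= s)%N -> j != k ->
  \sum_m haar z m j * haar z' m k = 0.
Proof.
wlog: z z' j k / (j < k)%N => [th js ks jk|jk _ ks _].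
  have [lt|] := ltnP j k; first exact: th.
  rewrite leq_eqVlt eq_sym (negbTE jk) => /= lt.
  by under eq_bigr do rewrite mulrC; apply: th; rewrite // eq_sym.
case: k => // k in jk ks *.
apply: (mulIf b_neq0); rewrite mul0r mulr_natr (sum_shift _ (Ordinal ks)).
apply: big1 => m _.
have E c : haar z (m + c *: delta_mx (Ordinal ks) ord0) j = haar z m j.
  rewrite /haar prefix_value_shift; last by rewrite /=; lia.
  congr (_ * (_ + _ * _)); case: j jk => //= j jk;
  by rewrite digit_shift ifN //= ltn_eqF.
under eq_bigr do rewrite E /haar prefix_value_shift //= digit_shift eqxx.
rewrite -mulr_sumr -mulr_sumr.
set t := tail_value z' _.
pose h i : R := (digit z' k <= i)%:R - 1 + (digit z' k)%:R / b%:R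
   + (b%:R^-1 - (digit z' k == i)%:R) * t.
rewrite [X in _ * (_ * X)](_ : _ = \sum_(0 <= i < b) h i); last first.
  by rewrite -(sum_Fp_shift h (m (Ordinal ks) ord0)); apply: eq_bigr.
rewrite /h !big_split /= -mulr_suml !sumr_const_nat sum_nat_leqn; last first.
  by rewrite ltnW // digit_lt.
rewrite -mulr_suml sumrB sum_nat_eqn ?digit_lt // sumr_const_nat !subn0
  -[-1 *+ b]mulr_natr -[(digit _ _)%:R *+ b]mulr_natr -[b%:R^-1 *+ b]mulr_natr.
by rewrite [X in _ * (_ * X)](_ : _ = 0) ?mulr0 //; field.
Qed.

(* The part of [haar z m j] of weight [b ^- k]: of [z] it sees only the first [j]
   digits and the digit number [j + k] (counted from 1). *)
Definition haar_piece z m j k : R :=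
  (prefix_value z j.-1 == prefix_value m j.-1)%:R *
  (if k is k'.+1 then haar_slope z m j * (digit z (j + k'))%:R
   else haar_scale z m j).

Lemma haar_sum_pieces z m j :
  haar z m j = \sum_(k < s.+1) haar_piece z m j k / b%:R ^+ k.
Proof.
rewrite big_ord_recl /haar /haar_piece /= expr0 divr1 mulrDr; congr (_ + _).
rewrite /tail_value !mulr_sumr; apply: eq_bigr => k _.
by rewrite /= add0n !mulrA.
Qed.

Lemma haar_piece_le z m j k : `|haar_piece z m j k| <=
  b%:R * (prefix_value z j.-1 == prefix_value m j.-1)%:R.
Proof.
have b2 : 2 <= b%:R :> R by rewrite (ler_nat _ 2) prime_gt1.
have dl : forall k, (digit z k)%:R <= b%:R :> R.
  by move=> l; rewrite ler_nat ltnW // digit_lt.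
rewrite /haar_piece normrM normr_nat mulrC ler_wpM2r //.
have iv0 : 0 < b%:R^-1 :> R by rewrite invr_gt0.
have iv1 : b%:R^-1 <= 1 :> R by rewrite invf_le1 //; lra.
case: k => [|k].
  case: j => [|j] /=; first by rewrite normr1; lra.
  have q1 : (digit z j)%:R / b%:R <= 1 :> R by rewrite ler_pdivrMr // mul1r.
  have q0 : 0 <= (digit z j)%:R / b%:R :> R by rewrite divr_ge0 // ltW.
  by rewrite ler_norml; case: (_ <= _)%N => /=; apply/andP; split; lra.
rewrite normrM normr_nat -[leRHS]mul1r ler_pM //.
case: j => [|j] /=; first by rewrite normrN normr1.
by rewrite ler_norml; case: (_ == _)%N => /=; apply/andP; split; lra.
Qed.

(** The hypothesis has the shape asked for by [net_words_equidistributed2]. For [k = 0], the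
    alternative [l.+1 == j] is a case of [l < j]. *)
Lemma haar_piece_local z z' m j k :
  (forall l : 'I_s, (l < j)%N || (l.+1 == j + k)%N ->
    z l ord0 = z' l ord0) ->
  haar_piece z m j k = haar_piece z' m j k.
Proof.
move=> E.
have Ed l : (l < j)%N || (l.+1 == j + k)%N -> digit z l = digit z' l.
  move=> H; have [ls|sl] := ltnP l s; last by rewrite !digit_ge.
  by rewrite (digit_ord z (Ordinal ls)) (digit_ord z' (Ordinal ls)) E.
rewrite /haar_piece.
have -> : prefix_value z j.-1 = prefix_value z' j.-1.
  apply/eq_prefix_value => l lj; rewrite Ed //; lia.
have Es : haar_scale z m j = haar_scale z' m j.
  by case: j E Ed => //= j _ Ed; rewrite Ed //; lia.
have El : haar_slope z m j = haar_slope z' m j.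
  by case: j E Ed {Es} => //= j _ Ed; rewrite Ed //; lia.
by case: k E Ed => [|k] _ Ed; rewrite ?Es // El Ed //; lia.
Qed.

End Words.

(** * Orthogonality of tensor products *)

Section TensorOrthogonality.
Variables (R : numDomainType) (I T J : finType).
Variables (w : {ffun I -> T} -> R) (g : J -> T -> T -> R).
Hypothesis g_orth : forall j k z z', j != k -> \sum_m g j z m * g k z' m = 0.

Definition tensor_component (j : {ffun I -> J}) (m : {ffun I -> T}) : R :=
  \sum_z w z * \prod_i g (j i) (z i) (m i).

Lemma sum_tensor_component (m : {ffun I -> T}) :
  \sum_z w z * \prod_i (\sum_j g j (z i) (m i)) = \sum_j tensor_component j m.
Proof.
rewrite exchange_big /=; apply: eq_bigr => z _.
by rewrite bigA_distr_bigA mulr_sumr.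
Qed.

(** Orthogonality holds for each pair [z], [z'] separately, whatever the weights: the sum over [m]
    factors over the coordinates, and a coordinate where [j] and [k] differ contributes a factor
    0. *)
Lemma tensor_component_orthogonal j k : j != k ->
  \sum_m tensor_component j m * tensor_component k m = 0.
Proof.
move=> jk; have [i jki] : exists i, j i != k i.
  apply/existsP; apply: contraR jk; rewrite negb_exists => /forallP E.
  by apply/eqP/ffunP => i; have := E i; rewrite negbK => /eqP.
under eq_bigr do rewrite mulr_suml.
rewrite exchange_big big1 //= => z _.
under eq_bigr do rewrite mulr_sumr.
rewrite exchange_big big1 //= => z' _.
under eq_bigr do rewrite mulrACA -big_split /=.
rewrite -mulr_sumr -(bigA_distr_bigA (fun i (x : T) => g (j i) (z i) x * g (k i) (z' i) x)).
by rewrite (bigD1 i) //= g_orth // mul0r mulr0.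
Qed.

Lemma sum_sqr_tensor :
  \sum_(m : {ffun I -> T}) (\sum_z w z * \prod_i (\sum_j g j (z i) (m i))) ^+ 2 =
  \sum_j \sum_m tensor_component j m ^+ 2.
Proof.
under eq_bigr do rewrite sum_tensor_component expr2 mulr_suml.
rewrite exchange_big /=; apply: eq_bigr => j _.
under eq_bigr do rewrite mulr_sumr.
rewrite exchange_big (bigD1 j) //= [X in _ + X]big1 ?addr0 // => k kj.
by rewrite tensor_component_orthogonal // eq_sym.
Qed.

End TensorOrthogonality.

(** * Digital nets *)

(** A free family is the family of rows of a matrix with a right inverse, which applied to the
    prescribed values gives [u]. *)
Lemma free_solve (F : fieldType) (n : nat) (X : seq 'rV[F]_n) (f : nat -> F) :
  free X -> exists u : 'cV_n, forall l, (l < size X)%N -> (X`_l *m u) ord0 ord0 = f l.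
Proof.
move=> fX; pose M := \matrix_(l < size X) X`_l.
have /row_freeP[B MB] : row_free M.
  apply: inj_row_free => v; rewrite mulmx_sum_row => E; apply/rowP => l.
  have /freeP fX' : free (in_tuple X) by [].
  rewrite mxE (fX' (v ord0)) // -[RHS]E; apply: eq_bigr => i _.
  by rewrite rowK.
exists (B *m \col_(l < size X) f l) => l lX.
have -> : X`_l = row (Ordinal lX) M by rewrite rowK.
by rewrite mulmxA -row_mul MB -row_mul mul1mx !mxE.
Qed.

(** The largest entry is at most [j + k], counted from 1, and the next one lies among the first [j].
    This is where order 2 enters: controlling the first [j] digits and one more costs only
    [2 * j + k]. *)
Lemma sorted_gtn_take2 (s j k : nat) (l : seq 'I_s) :
  sorted (fun x y : 'I_s => y < x)%N l ->
  all (fun x : 'I_s => (x < j)%N || (x.+1 == j + k)%N) l ->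
  (\sum_(x <- take 2 l) x.+1 <= 2 * j + k)%N.
Proof.
case: l => [|x [|y l]] /=; first by rewrite big_nil.
  rewrite big_seq1 andbT => _; lia.
rewrite !big_cons take0 big_nil => /andP[yx _] /and3P[]; lia.
Qed.

Lemma sorted_filter_rev_enum (s : nat) (P : pred 'I_s) :
  sorted (fun x y : 'I_s => y < x)%N [seq x <- rev (enum 'I_s) | P x].
Proof.
apply: sorted_filter => [x y z /= h1 h2|]; first exact: ltn_trans h1.
rewrite rev_sorted.
have := iota_ltn_sorted 0 s; rewrite -val_enum_ord sorted_map.
by [].
Qed.

Section Net.
Variables (b d s n v : nat).
Hypothesis b_pr : prime b.
Variable C : 'I_d -> 'M['F_b]_(s, n).
Local Notation word := 'cV['F_b]_s.
Local Notation words := {ffun 'I_d -> 'cV['F_b]_s}.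
Hypothesis C_net : forall lam : 'I_d -> seq 'I_s,
  (forall i, sorted (fun k l : 'I_s => (l < k)%N) (lam i)) ->
  (\sum_(i < d) \sum_(k <- take 2 (lam i)) k.+1 <= 2 * n - v)%N ->
  free (flatten [seq [seq row k (C i) | k <- lam i] | i <- enum 'I_d]).

Definition net_words (y : 'cV['F_b]_n) : words := [ffun i => C i *m y].

Lemma net_words_solve (lam : 'I_d -> seq 'I_s) (z : words) :
  free (flatten [seq [seq row k (C i) | k <- lam i] | i <- enum 'I_d]) ->
  exists y, forall i k, k \in lam i -> net_words y i k ord0 = z i k ord0.
Proof.
pose P := [seq (i, k) | i <- enum 'I_d, k <- lam i].
have -> : flatten [seq [seq row k (C i) | k <- lam i] | i <- enum 'I_d] =
          [seq row p.2 (C p.1) | p <- P] by rewrite map_allpairs.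
have inP i k : k \in lam i -> (i, k) \in P.
  by move=> ki; apply/allpairsPdep; exists i, k; rewrite mem_enum.
(* An empty selection imposes no condition; otherwise its first pair serves as the default value of
   [nth]. *)
case EP: P => [|p0 P']; first by move=> _; exists 0 => i k /inP; rewrite EP.
rewrite -{}EP => /(free_solve (fun l => z (nth p0 P l).1 (nth p0 P l).2 ord0))[y yP].
exists y => i k /inP iP; have iP' := iP; rewrite -index_mem in iP'.
have := yP (index (i, k) P); rewrite size_map => /(_ iP').
by rewrite (nth_map p0) // nth_index //= -row_mul mxE ffunE.
Qed.

(* The rows being independent, any [z] agrees on the selected digits with some
   [net_words u]; translating the net by [u] and averaging over [z] avoids
   counting fibres. *)
Lemma net_words_equidistributed (V : zmodType) (F : words -> V)
    (lam : 'I_d -> seq 'I_s) :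
  free (flatten [seq [seq row k (C i) | k <- lam i] | i <- enum 'I_d]) ->
  (forall z z' : words, (forall i k, k \in lam i -> z i k ord0 = z' i k ord0) -> F z = F z') ->
  (\sum_y F (net_words y)) *+ #|{: words}| = (\sum_z F z) *+ #|{: 'cV['F_b]_n}|.
Proof.
move=> fr Floc; rewrite -!sumr_const.
transitivity (\sum_(z : words) \sum_y F (net_words y + z)).
  apply: eq_bigr => z _; have [u uP] := net_words_solve z fr.
  rewrite (reindex_inj (addIr u)); apply: eq_bigr => y _; apply: Floc => i k ki.
  by have := uP i k ki; rewrite !ffunE mulmxDr !mxE => ->.
rewrite exchange_big; apply: eq_bigr => y _.
by rewrite [RHS](reindex_inj (addrI (net_words y))).
Qed.

Lemma net_words_equidistributed2 (V : zmodType) (F : words -> V) (j k : 'I_d -> nat) :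
  (\sum_i (2 * j i + k i) <= 2 * n - v)%N ->
  (forall z z' : words, (forall i (l : 'I_s), (l < j i)%N || (l.+1 == j i + k i)%N ->
     z i l ord0 = z' i l ord0) -> F z = F z') ->
  (\sum_y F (net_words y)) *+ #|{: words}| = (\sum_z F z) *+ #|{: 'cV['F_b]_n}|.
Proof.
move=> jk Floc.
(* The net condition asks for decreasing lists while [enum] is increasing, hence [rev]. *)
pose lam i := [seq l : 'I_s <- rev (enum 'I_s) | (l < j i)%N || (l.+1 == j i + k i)%N].
apply: (@net_words_equidistributed _ _ lam) => [|z z' E].
  apply: C_net => [i|]; first exact: sorted_filter_rev_enum.
  apply: leq_trans jk; apply: leq_sum => i _; apply: sorted_gtn_take2.
    exact: sorted_filter_rev_enum.
  exact: filter_all.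
apply: Floc => i l H; apply: E.
by rewrite mem_filter mem_rev mem_enum H.
Qed.

Lemma card_words : #|{: words}| = ((b ^ s) ^ d)%N.
Proof. by rewrite card_ffun card_word // card_ord. Qed.

(** * Means over the net and over all families of words *)

Variable R : realFieldType.
Local Notation B := (b%:R : R).

Let b_gt0 : 0 < B. Proof. by rewrite ltr0n prime_gt0. Qed.
Let bX_gt0 k : 0 < B ^+ k. Proof. by rewrite exprn_gt0. Qed.
Let bX_neq0 k : B ^+ k != 0. Proof. by rewrite gt_eqF. Qed.
Let bXX_neq0 k l : (B ^+ k) ^+ l != 0. Proof. by rewrite gt_eqF // exprn_gt0. Qed.

Definition net_mean (F : words -> R) : R := (\sum_y F (net_words y)) / B ^+ n.
Definition uniform_mean (F : words -> R) : R := (\sum_z F z) / (B ^+ s) ^+ d.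

(** The signed density of the net against the uniform distribution, which puts a difference of means
    in the form of a [tensor_component]. *)
Definition net_weight (z : words) : R :=
  net_mean (fun z' => (z' == z)%:R) - 1 / (B ^+ s) ^+ d.

Lemma sum_net_weight F :
  \sum_z net_weight z * F z = net_mean F - uniform_mean F.
Proof.
under eq_bigr do rewrite mulrBl; rewrite sumrB; congr (_ - _); last first.
  by rewrite /uniform_mean mulr_suml; apply: eq_bigr => z _; rewrite div1r mulrC.
rewrite /net_mean; under eq_bigr do rewrite mulrAC mulr_suml.
rewrite -mulr_suml exchange_big /=; congr (_ / _); apply: eq_bigr => y _.
rewrite (bigD1 (net_words y)) //= eqxx mul1r big1 ?addr0 // => z /negbTE nz.
by rewrite eq_sym nz mul0r.
Qed.

Lemma net_mean_eq (F : words -> R) (j k : 'I_d -> nat) :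
  (\sum_i (2 * j i + k i) <= 2 * n - v)%N ->
  (forall z z' : words, (forall i (l : 'I_s), (l < j i)%N || (l.+1 == j i + k i)%N ->
     z i l ord0 = z' i l ord0) -> F z = F z') ->
  net_mean F = uniform_mean F.
Proof.
move=> jk Floc; have := net_words_equidistributed2 jk Floc.
rewrite card_words card_word // -[LHS]mulr_natr -[RHS]mulr_natr !natrX => E.
by apply/eqP; rewrite /net_mean /uniform_mean eqr_div // E.
Qed.

Lemma ler_net_mean F G : (forall z, F z <= G z) -> net_mean F <= net_mean G.
Proof. by move=> FG; rewrite ler_pM2r ?invr_gt0 //; apply: ler_sum. Qed.

Lemma ler_uniform_mean F G : (forall z, F z <= G z) -> uniform_mean F <= uniform_mean G.
Proof. by move=> FG; rewrite ler_pM2r ?invr_gt0 ?exprn_gt0 //; apply: ler_sum. Qed.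

(** The indicator of the [b]-adic elementary box around [m] with sides [b ^- (a i)]. *)
Definition box (a : 'I_d -> nat) (m z : words) : R :=
  \prod_i (prefix_value (z i) (a i) == prefix_value (m i) (a i))%:R.

Lemma boxC a m z : box a m z = box a z m.
Proof. by apply: eq_bigr => i _; rewrite eq_sym. Qed.

Lemma box_ge0 a m z : 0 <= box a m z.
Proof. exact: prodr_ge0. Qed.

Lemma uniform_mean_box a m : (forall i, a i <= s)%N ->
  uniform_mean (box a m) = (B ^+ (\sum_i a i))^-1.
Proof.
move=> as_; rewrite /uniform_mean /box.
rewrite -(bigA_distr_bigA (fun i (z : word) =>
  (prefix_value z (a i) == prefix_value (m i) (a i))%:R)).
under eq_bigr do rewrite sum_prefix_value_eq //.
rewrite big_split /= prodr_const card_ord mulrC mulKf //.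
by rewrite prodfV expr_sum.
Qed.

(** Induction on the excess of the sum over [t], lowering a positive entry by 1. *)
Lemma leq_sum_exists_sub (a : 'I_d -> nat) t : (t <= \sum_i a i)%N ->
  exists2 a' : 'I_d -> nat, (forall i, a' i <= a i)%N & (\sum_i a' i = t)%N.
Proof.
move=> ta; have [r] := ubnP (\sum_i a i - t)%N.
elim: r a ta => // r IH a ta; rewrite ltnS => le_r.
have [->|ne] := eqVneq t (\sum_i a i)%N; first by exists a.
have [i ai] : exists i, (0 < a i)%N.
  apply/existsP; apply: contraR ne; rewrite negb_exists => /forallP E.
  have E0 : (\sum_i a i = 0)%N.
    by rewrite big1 // => i _; have := E i; rewrite -eqn0Ngt => /eqP.
  by move: ta; rewrite E0 leqn0.
pose a1 k := if k == i then (a i).-1 else a k.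
have Sa : (\sum_k a k = (\sum_k a1 k).+1)%N.
  rewrite (bigD1 i) //= [in RHS](bigD1 i) //= /a1 eqxx -addSn prednK //.
  by congr addn; apply: eq_bigr => k /negbTE ->.
have lea1 k : (a1 k <= a k)%N by rewrite /a1; case: eqP => // ->; exact: leq_pred.
have [||a' a'1 <-] := IH a1; [lia|lia|].
by exists a' => // k; apply: leq_trans (lea1 k).
Qed.

(** The box lies in a coarser one of order exactly [minn (\sum_i a i) (n - v)]. The net gives the
    latter its uniform mean, as [2 * (n - v) <= 2 * n - v]; coarsening costs at most [B ^+ v]. *)
Lemma net_mean_box a m : (forall i, a i <= s)%N ->
  net_mean (box a m) <= B ^+ v / B ^+ minn (\sum_i a i) n.
Proof.
move=> as_; have [|a' a'a Sa'] := @leq_sum_exists_sub a (minn (\sum_i a i) (n - v)).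
  exact: geq_minl.
apply: (@le_trans _ _ (net_mean (box a' m))).
  apply: ler_net_mean => z; apply: ler_prod => i _; rewrite ler0n /= ler_nat.
  by case: eqP => // E; rewrite (eq_prefix_value_le b_pr (a'a i) E) eqxx.
rewrite (@net_mean_eq _ a' (fun=> 0%N)); first last.
- move=> z z' E; apply: eq_bigr => i _; congr (_ == _)%:R.
  apply/(eq_prefix_value b_pr) => l la; have ls : (l < s)%N.
    by apply: leq_trans (as_ i); apply: leq_trans (a'a i).
  by rewrite (digit_ord (z i) (Ordinal ls)) (digit_ord (z' i) (Ordinal ls)) E //= la.
- under eq_bigr do rewrite addn0.
  rewrite -big_distrr /= Sa'; lia.
rewrite uniform_mean_box; last by move=> i; apply: leq_trans (as_ i).
rewrite Sa' ler_pdivlMr // mulrC ler_pdivrMr // -exprD ler_weXn2l //; last by lia.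
by rewrite (ler_nat _ 1) prime_gt0.
Qed.

(** * Bounds for the Haar components of the discrepancy *)

Definition haar_component (j : {ffun 'I_d -> 'I_s.+1}) (m : words) : R :=
  tensor_component net_weight (fun (j : 'I_s.+1) z m => haar R z m j) j m.

Definition haar_pieces (j k : {ffun 'I_d -> 'I_s.+1}) (m z : words) : R :=
  \prod_i haar_piece R (z i) (m i) (j i) (k i).

Lemma haar_component_pieces j m : haar_component j m =
  \sum_(k : {ffun 'I_d -> 'I_s.+1})
    (net_mean (haar_pieces j k m) - uniform_mean (haar_pieces j k m)) / B ^+ (\sum_i k i).
Proof.
rewrite /haar_component /tensor_component.
under eq_bigr => z _.
  under eq_bigr do rewrite haar_sum_pieces.
  rewrite bigA_distr_bigA mulr_sumr.
  under eq_bigr => k _ do rewrite big_split /= prodfV -expr_sum mulrA.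
  over.
rewrite exchange_big /=; apply: eq_bigr => k _.
by rewrite -mulr_suml sum_net_weight.
Qed.

Lemma haar_pieces_le j k m z :
  `|haar_pieces j k m z| <= B ^+ d * box (fun i => (j i).-1) m z.
Proof.
rewrite normr_prod (_ : B ^+ d = \prod_(i < d) B); last first.
  by rewrite prodr_const card_ord.
rewrite -big_split /=.
by apply: ler_prod => i _; rewrite normr_ge0 haar_piece_le.
Qed.

Lemma norm_net_mean F : `|net_mean F| <= net_mean (fun z => `|F z|).
Proof.
rewrite /net_mean normrM [X in _ * X]ger0_norm ?invr_ge0 ?(ltW (bX_gt0 _)) //.
by rewrite ler_wpM2r ?invr_ge0 ?(ltW (bX_gt0 _)) // ler_norm_sum.
Qed.

Lemma norm_uniform_mean F : `|uniform_mean F| <= uniform_mean (fun z => `|F z|).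
Proof.
rewrite /uniform_mean normrM [X in _ * X]ger0_norm ?invr_ge0 ?exprn_ge0 ?(ltW (bX_gt0 _)) //.
by rewrite ler_wpM2r ?invr_ge0 ?exprn_ge0 ?(ltW (bX_gt0 _)) // ler_norm_sum.
Qed.

Lemma net_meanZ c F : net_mean (fun z => c * F z) = c * net_mean F.
Proof. by rewrite /net_mean -mulr_sumr mulrA. Qed.

Lemma uniform_meanZ c F : uniform_mean (fun z => c * F z) = c * uniform_mean F.
Proof. by rewrite /uniform_mean -mulr_sumr mulrA. Qed.

Lemma uniform_meanD F G :
  uniform_mean (fun z => F z + G z) = uniform_mean F + uniform_mean G.
Proof. by rewrite /uniform_mean big_split mulrDl. Qed.

Lemma uniform_mean_cst c : uniform_mean (fun=> c) = c.
Proof.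
by rewrite /uniform_mean sumr_const card_words -[c *+ _]mulr_natr !natrX mulfK.
Qed.

Lemma net_mean_cst c : net_mean (fun=> c) = c.
Proof.
by rewrite /net_mean sumr_const card_word // -[c *+ _]mulr_natr natrX mulfK.
Qed.

Lemma uniform_net_mean (F : words -> words -> R) :
  uniform_mean (fun m => net_mean (F m)) = net_mean (fun z => uniform_mean (F^~ z)).
Proof.
rewrite /uniform_mean /net_mean -!mulr_suml exchange_big /= mulrAC.
by congr (_ * _ * _); apply: eq_bigr.
Qed.

Definition level (j : {ffun 'I_d -> 'I_s.+1}) : nat := \sum_i j i.

(** The product of pieces depends only on digits that the net equidistributes when
    [2 * level j + level k <= 2 * n - v], and then the means agree. Otherwise they are bounded
    separately. *)
Lemma haar_pieces_mean_diff j k m :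
  `|net_mean (haar_pieces j k m) - uniform_mean (haar_pieces j k m)| <=
  (2 * n - v < 2 * level j + level k)%N%:R * (B ^+ d *
   (net_mean (box (fun i => (j i).-1) m) + uniform_mean (box (fun i => (j i).-1) m))).
Proof.
have [le_jk|_] := leqP.
  rewrite mul0r (@net_mean_eq _ (fun i => j i) (fun i => k i)) ?subrr ?normr0 //.
    by rewrite big_split -big_distrr.
  move=> z z' E; apply: eq_bigr => i _; apply: haar_piece_local => //.
  exact: E.
rewrite mul1r mulrDr -net_meanZ -uniform_meanZ.
apply: le_trans (ler_normB _ _) _; apply: lerD.
  by apply: le_trans (norm_net_mean _) _; apply: ler_net_mean => z; exact: haar_pieces_le.
by apply: le_trans (norm_uniform_mean _) _; apply: ler_uniform_mean => z; exact: haar_pieces_le.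
Qed.

Definition tail_weight (j : {ffun 'I_d -> 'I_s.+1}) : R :=
  \sum_(k : {ffun 'I_d -> 'I_s.+1})
    (2 * n - v < 2 * level j + level k)%N%:R / B ^+ level k.

Lemma haar_component_le j m :
  `|haar_component j m| <= tail_weight j * (B ^+ d *
   (net_mean (box (fun i => (j i).-1) m) + uniform_mean (box (fun i => (j i).-1) m))).
Proof.
rewrite haar_component_pieces mulr_suml; apply: le_trans (ler_norm_sum _ _ _) _.
apply: ler_sum => k _; rewrite normrM [X in _ * X]ger0_norm ?invr_ge0 ?(ltW (bX_gt0 _)) //.
by rewrite mulrAC ler_wpM2r ?invr_ge0 ?(ltW (bX_gt0 _)) // haar_pieces_mean_diff.
Qed.

Lemma tail_weight_ge0 j : 0 <= tail_weight j.
Proof. by apply: sumr_ge0 => k _; rewrite divr_ge0 // ltW. Qed.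

Lemma leq_pred_ord (j : {ffun 'I_d -> 'I_s.+1}) i : ((j i).-1 <= s)%N.
Proof. by have := ltn_ord (j i); lia. Qed.

(** One factor of the square is bounded by its maximum, the other is averaged over [m]: as [box] is
    symmetric, exchanging the two means shows that the net mean of the box around [m] averages to
    [u]. The entries of [a] are those of [j] less 1, because the indicator in [haar_piece] stops
    there. *)
Lemma uniform_mean_sqr_box (j : {ffun 'I_d -> 'I_s.+1}) (a := fun i => (j i).-1)
    (u := (B ^+ (\sum_i a i))^-1) :
  uniform_mean (fun m => (net_mean (box a m) + uniform_mean (box a m)) ^+ 2) <=
    2 * u * (B ^+ v / B ^+ minn (\sum_i a i) n + u).
Proof.
have ub m : uniform_mean (box a m) = u by rewrite uniform_mean_box //; exact: leq_pred_ord.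
have u0 : 0 <= u by rewrite invr_ge0 ltW.
set p := B ^+ v / _.
apply: (@le_trans _ _ (uniform_mean (fun m => (p + u) * (net_mean (box a m) + u)))).
  apply: ler_uniform_mean => m; rewrite ub expr2.
  have nm0 : 0 <= net_mean (box a m).
    by rewrite divr_ge0 ?(ltW (bX_gt0 _)) // sumr_ge0 // => *; exact: box_ge0.
  rewrite ler_wpM2r ?addr_ge0 // lerD2r; apply: net_mean_box; exact: leq_pred_ord.
rewrite uniform_meanZ uniform_meanD uniform_mean_cst uniform_net_mean.
have -> : net_mean (fun z => uniform_mean (fun m => box a m z)) = u.
  rewrite -[RHS]net_mean_cst; congr (_ / _); apply: eq_bigr => y _.
  by rewrite -(ub (net_words y)); congr (_ / _); apply: eq_bigr => z _; exact: boxC.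
by rewrite mulrC mulr_natl mulr2n.
Qed.

Lemma uniform_mean_sqr_component j :
  uniform_mean (fun m => haar_component j m ^+ 2) <=
  (tail_weight j * B ^+ d) ^+ 2 * (4 * B ^+ (v + 2 * d) / B ^+ (level j + minn (level j) n)).
Proof.
pose a i := (j i).-1; pose u := (B ^+ (\sum_i a i))^-1.
apply: (@le_trans _ _ (uniform_mean (fun m => (tail_weight j * B ^+ d) ^+ 2 *
    (net_mean (box a m) + uniform_mean (box a m)) ^+ 2))).
  apply: ler_uniform_mean => m; rewrite -exprMn -mulrA -[leLHS]real_normK ?num_real //.
  by apply: lerXn2r (haar_component_le j m); rewrite nnegrE // (le_trans _ (haar_component_le j m)).
rewrite uniform_meanZ ler_wpM2l ?sqr_ge0 //.
apply: le_trans (uniform_mean_sqr_box j) _; rewrite -/a -/u.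
have B1 : 1 <= B by rewrite (ler_nat _ 1) prime_gt0.
(* Each entry of [a] is at most 1 below that of [j], so passing from [a] to [j] costs a factor
   [B ^+ d]. This happens twice, whence [2 * d] in the exponent. *)
have la : (level j <= \sum_i a i + d)%N.
  rewrite -[X in (_ + X)%N](card_ord d) -sum1_card -big_split /=.
  by apply: leq_sum => i _; rewrite /a; lia.
have uj : u <= B ^+ d / B ^+ level j.
  by rewrite /u ler_pdivlMr // mulrC ler_pdivrMr // -exprD ler_weXn2l // addnC.
have uj' : u <= B ^+ (v + d) / B ^+ minn (level j) n.
  rewrite /u ler_pdivlMr // mulrC ler_pdivrMr // -exprD ler_weXn2l //; lia.
have pj : B ^+ v / B ^+ minn (\sum_i a i) n <= B ^+ (v + d) / B ^+ minn (level j) n.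
  rewrite ler_pdivlMr // mulrAC ler_pdivrMr // -!exprD ler_weXn2l //; lia.
have u0 : 0 <= u by rewrite invr_ge0 ltW.
apply: (@le_trans _ _ (2 * (B ^+ d / B ^+ level j) * (2 * (B ^+ (v + d) / B ^+ minn (level j) n)))).
  rewrite ler_pM ?mulr_ge0 ?addr_ge0 ?divr_ge0 ?(ltW (bX_gt0 _)) //.
    by rewrite ler_pM2l.
  by rewrite [leRHS]mulr_natl mulr2n lerD.
rewrite le_eqVlt; apply/orP; left; apply/eqP.
have -> : B ^+ (v + 2 * d) = B ^+ v * B ^+ d * B ^+ d.
  by rewrite -!exprD; congr (_ ^+ _); lia.
rewrite [B ^+ (v + d)]exprD [B ^+ (level j + _)]exprD; field.
by rewrite !bX_neq0.
Qed.

(* Any [tau] with [1 / b < tau < 1] and [b * tau ^ 2 < 1], bounded away from both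
   constraints, would do. *)
Let tau : R := 4 / (3 * B).
Let B2 : 2 <= B. Proof. by rewrite (ler_nat _ 2) prime_gt1. Qed.
Let tau_gt0 : 0 < tau. Proof. by rewrite divr_gt0 ?mulr_gt0. Qed.
Let tauB : tau * B = 4 / 3. Proof. by rewrite /tau; field; rewrite gt_eqF. Qed.
Let tau_lt1 : tau < 1. Proof. by rewrite ltr_pdivrMr ?mulr_gt0 // mul1r; move: B2; lra. Qed.

(** Write [B^-1 = 3 / 4 * tau]. A contributing [k] satisfies [2 * (n - level j) <= level k + v], so
    [tau ^+ level k] is at most [tau ^+ (2 * (n - level j)) / tau ^+ v]; what remains, the powers of
    [3 / 4], sums to at most [4 ^+ d]. *)
Lemma tail_weight_le j :
  tail_weight j <= 4 ^+ d / tau ^+ v * tau ^+ (2 * (n - level j)).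
Proof.
apply: (@le_trans _ _ (\sum_(k : {ffun 'I_d -> 'I_s.+1})
    (3 / 4) ^+ (\sum_i k i) * (tau ^+ (2 * (n - level j)) / tau ^+ v))).
  apply: ler_sum => k _; rewrite -/(level k).
  have tX l : 0 < tau ^+ l by rewrite exprn_gt0.
  case: leqP => [_|lt_jk].
    by rewrite mul0r mulr_ge0 // ?exprn_ge0 // ?divr_ge0 // ?(ltW (tX _)).
  rewrite mul1r -exprVn (_ : B^-1 = 3 / 4 * tau); last by rewrite /tau; field; rewrite gt_eqF.
  rewrite exprMn ler_wpM2l ?exprn_ge0 ?divr_ge0 //.
  rewrite ler_pdivlMr // -exprD ler_wiXn2l ?(ltW tau_gt0) ?(ltW tau_lt1) //; lia.
rewrite -mulr_suml [leRHS]mulrAC -[leRHS]mulrA ler_wpM2r //.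
  by rewrite divr_ge0 // exprn_ge0 // (ltW tau_gt0).
rewrite [4 in leRHS](_ : 4 = (1 - 3 / 4)^-1); last by field.
by apply: sum_ffun_geometric_le; lra.
Qed.

Definition component_bound : R :=
  (4 ^+ d / tau ^+ v * B ^+ d) ^+ 2 * (4 * B ^+ (v + 2 * d)).

(** If [level j = n - r], then [tau ^+ (4 * r)] outweighs the loss [B ^+ (2 * r)], since
    [tau ^+ 2 * B = 16 / (9 * B) <= 8 / 9]. If [level j > n], the decay comes from [B^-1 <= 1 / 2]
    alone. The truncated differences add up to the distance from [level j] to [n]. *)
Lemma uniform_mean_sqr_component_le j :
  uniform_mean (fun m => haar_component j m ^+ 2) <=
  component_bound *
    ((8 / 9) ^+ ((level j - n) + (n - level j)) / B ^+ (2 * n)).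
Proof.
apply: le_trans (uniform_mean_sqr_component j) _.
have tX l : 0 < tau ^+ l by rewrite exprn_gt0.
pose K := 4 ^+ d / tau ^+ v; pose X := tau ^+ (2 * (n - level j)).
have tw : tail_weight j * B ^+ d <= K * X * B ^+ d.
  by rewrite ler_wpM2r ?(ltW (bX_gt0 _)) // tail_weight_le.
set E := B ^+ (level j + minn (level j) n).
apply: (@le_trans _ _ ((K * X * B ^+ d) ^+ 2 * (4 * B ^+ (v + 2 * d) / E))).
  rewrite ler_wpM2r ?divr_ge0 ?mulr_ge0 ?(ltW (bX_gt0 _)) //.
  have t0 : 0 <= tail_weight j * B ^+ d by rewrite mulr_ge0 ?tail_weight_ge0 ?(ltW (bX_gt0 _)).
  by rewrite lerXn2r // nnegrE // (le_trans t0).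
have -> : (K * X * B ^+ d) ^+ 2 * (4 * B ^+ (v + 2 * d) / E) =
    component_bound * (X ^+ 2 / E).
  by rewrite /component_bound -/K; ring.
have K0 : 0 <= component_bound.
  by rewrite mulr_ge0 ?sqr_ge0 // mulr_ge0 ?(ltW (bX_gt0 _)).
rewrite ler_wpM2l // /X /E; case: (leqP (level j) n) => [jn|nj].
  set r := (n - level j)%N; rewrite (_ : level j - n + r = r)%N; last by rewrite /r; lia.
  have -> : (tau ^+ (2 * r)) ^+ 2 / B ^+ (level j + level j) =
      ((tau ^+ 2 * B) ^+ 2) ^+ r / B ^+ (2 * n).
    have -> : (2 * n = level j + level j + 2 * r)%N by rewrite /r; lia.
    have -> : ((tau ^+ 2 * B) ^+ 2) ^+ r = (tau ^+ (2 * r)) ^+ 2 * B ^+ (2 * r).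
      rewrite -exprM exprMn; congr (_ * _); rewrite -!exprM; congr (_ ^+ _); lia.
    by rewrite [B ^+ (_ + 2 * r)]exprD invfM mulrACA divff ?mulr1.
  rewrite ler_wpM2r ?invr_ge0 ?(ltW (bX_gt0 _)) // lerXn2r ?nnegrE ?sqr_ge0 ?divr_ge0 //.
  have y0 : 0 <= tau ^+ 2 * B by rewrite mulr_ge0 ?sqr_ge0 // ltW.
  have y1 : tau ^+ 2 * B <= 8 / 9.
    rewrite expr2 -mulrA tauB /tau mulrAC ler_pdivrMr ?mulr_gt0 //; move: B2; lra.
  by rewrite expr2; nra.
rewrite (_ : n - level j = 0)%N; last by lia.
rewrite muln0 expr0 expr1n div1r addn0 ler_pdivlMr // mulrC.
rewrite (_ : level j + n = 2 * n + (level j - n))%N; last by lia.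
rewrite exprD invfM mulVKf // -exprVn lerXn2r ?nnegrE ?invr_ge0 ?divr_ge0 ?(ltW b_gt0) //.
rewrite -div1r ler_pdivrMr //; move: B2; lra.
Qed.

(** * Parseval identity for the discrepancy *)

Definition below (m z : words) : R :=
  \prod_i (prefix_value (z i) s <= prefix_value (m i) s)%:R.

Lemma uniform_mean_below m :
  uniform_mean (below m) = \prod_i ((prefix_value (m i) s).+1%:R / B ^+ s).
Proof.
rewrite /uniform_mean /below.
rewrite -(bigA_distr_bigA (fun i (z : word) => (prefix_value z s <= prefix_value (m i) s)%:R)).
rewrite big_split /= prodr_const card_ord -exprVn; congr (_ * _).
apply: eq_bigr => i _.
rewrite (@sum_word b s b_pr R (fun t => (t <= prefix_value (m i) s)%:R)).
by rewrite -(big_mkord xpredT (fun t => (t <= prefix_value (m i) s)%:R)) sum_nat_geqn //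
  prefix_value_lt.
Qed.

Lemma sum_sqr_net_discrepancy :
  uniform_mean (fun m => (net_mean (below m) - uniform_mean (below m)) ^+ 2) =
  \sum_(j : {ffun 'I_d -> 'I_s.+1}) uniform_mean (fun m => haar_component j m ^+ 2).
Proof.
rewrite /uniform_mean -mulr_suml; congr (_ / _).
rewrite /haar_component -sum_sqr_tensor; last first.
  move=> j k z z' jk; have js := leq_ord j; have ks := leq_ord k.
  have jk' : j != k :> nat by rewrite val_eqE.
  exact: (haar_orthogonal b_pr R z z' js ks jk').
apply: eq_bigr => m _; congr (_ ^+ 2).
rewrite -/(uniform_mean _) -sum_net_weight; apply: eq_bigr => z _; congr (_ * _).
by apply: eq_bigr => i _; rewrite sum_haar.
Qed.

End Net.

(** The constant is chosen before [s] and [n]. The level sums range over [d.+1] coordinates, hence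
    the power [d]. *)
Lemma uniform_mean_sqr_net_discrepancy (R : realFieldType) (b d v : nat) : prime b ->
  exists2 c : R, 0 <= c &
  forall (s n : nat) (C : 'I_d.+1 -> 'M['F_b]_(s, n)),
    (forall lam : 'I_d.+1 -> seq 'I_s,
      (forall i, sorted (fun k l : 'I_s => (l < k)%N) (lam i)) ->
      (\sum_(i < d.+1) \sum_(k <- take 2 (lam i)) k.+1 <= 2 * n - v)%N ->
      free (flatten [seq [seq row k (C i) | k <- lam i] | i <- enum 'I_d.+1])) ->
    uniform_mean (fun m => (net_mean C (below R m) - uniform_mean (below R m)) ^+ 2) <=
      c * n.+1%:R ^+ d / b%:R ^+ (2 * n) :> R.
Proof.
move=> b_pr; have [||c c0 cP] := @sum_ffun_geometric_dist_le R (8 / 9) _ _ d; [lra|lra|].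
have K0 : 0 <= component_bound b d.+1 v R.
  by rewrite mulr_ge0 ?sqr_ge0 // mulr_ge0 // exprn_ge0.
exists (component_bound b d.+1 v R * c) => [|s n C C_net]; first exact: mulr_ge0.
rewrite sum_sqr_net_discrepancy //.
apply: (@le_trans _ _ (\sum_(j : {ffun 'I_d.+1 -> 'I_s.+1}) component_bound b d.+1 v R *
    ((8 / 9) ^+ ((level j - n) + (n - level j)) / b%:R ^+ (2 * n)))).
  by apply: ler_sum => j _; apply: uniform_mean_sqr_component_le.
move: (component_bound _ _ _ _) K0 => K K0.
rewrite -mulr_sumr -mulr_suml -!mulrA ler_wpM2l // mulrA.
by rewrite ler_wpM2r ?invr_ge0 ?exprn_ge0 // cP.
Qed.

(** * From cells to the unit cube *)

Lemma modn_expnS b nu k : (0 < b)%N ->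
  (nu %% b ^ k.+1 = (nu %/ b ^ k %% b) * b ^ k + nu %% b ^ k)%N.
Proof.
move=> b0; have bk : (0 < b ^ k)%N by rewrite expn_gt0 b0.
rewrite {1}(divn_eq nu (b ^ k)) {1}(divn_eq (nu %/ b ^ k) b).
rewrite mulnDl -mulnA -expnS -addnA modnMDl modn_small //.
have := ltn_pmod (nu %/ b ^ k) b0; have := ltn_pmod nu bk.
rewrite expnS; nia.
Qed.

Lemma sum_digit_vector (V : nmodType) b n (F : 'cV['F_b]_n -> V) : prime b ->
  \sum_(nu < b ^ n) F (digit_vector b n nu) = \sum_y F y.
Proof.
move=> b_pr; pose f (nu : 'I_(b ^ n)) : 'cV['F_b]_n := digit_vector b n nu.
have b0 := prime_gt0 b_pr.
have f_inj : injective f.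
  move=> nu mu fE; apply: val_inj => /=.
  (* The digits determine [nu] modulo [b ^ k], by induction on [k]. *)
  suff E k : (k <= n)%N -> (nu %% b ^ k = mu %% b ^ k)%N.
    by have := E n (leqnn _); rewrite !modn_small.
  elim: k => [|k IH] kn; first by rewrite !modn1.
  rewrite !modn_expnS // IH ?(ltnW kn) //; congr (_ * _ + _)%N.
  have := congr1 (fun y : 'cV['F_b]_n => y (Ordinal kn) ord0 : nat) fE.
  by rewrite !mxE !val_Fp_nat // !modn_mod.
rewrite [RHS](reindex f) //; apply: onW_bij; apply: inj_card_bij => //.
by rewrite card_word // card_ord.
Qed.

Section MonotoneIntegral.
Local Open Scope ereal_scope.
Context (d : measure_display) (T : measurableType d) (R : realType).
Variable mu : {measure set T -> \bar R}.

(** Both integrals are suprema of integrals of simple functions, and a simple function below [f] is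
    below [g]. The squared discrepancy is taken as [f] without a proof that it is measurable. *)
Lemma ge0_le_integralT (f g : T -> \bar R) :
  (forall x, 0 <= f x) -> (forall x, f x <= g x) ->
  \int[mu]_x f x <= \int[mu]_x g x.
Proof.
move=> f0 fg; have g0 x : 0 <= g x by exact: le_trans (fg x).
rewrite !ge0_integralTE //; apply: le_ereal_sup => _ [h hf <-].
by exists h => // x; exact: le_trans (fg x).
Qed.

Lemma integral_sum_indic (I : finType) (c : I -> R) (A : I -> set T) :
  (forall i, 0 <= c i)%R -> (forall i, measurable (A i)) ->
  \int[mu]_x \sum_(i : I) (c i * \1_(A i) x)%:E = \sum_(i : I) (c i)%:E * mu (A i).
Proof.
move=> c0 mA; rewrite ge0_integral_sum //.
- apply: eq_bigr => i _; under eq_integral do rewrite EFinM.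
  rewrite ge0_integralZl_EFin //; last first.
    by apply/measurable_EFinP; exact: measurable_indic.
  by rewrite integral_indic // setIT.
- by move=> i; apply/measurable_EFinP; exact: measurable_funM.
- by move=> i x _; rewrite lee_fin mulr_ge0.
Qed.

End MonotoneIntegral.

Lemma measurable_euclidean_box (R : realType) (d : nat)
    (A : 'I_d -> set (measurableTypeR R)) :
  (forall i, measurable (A i)) ->
  measurable [set x : euclidean R d | forall i, A i (tnth x i)].
Proof.
move=> mA; rewrite (_ : mkset _ = \bigcap_(i in [set: 'I_d])
  ((fun x : euclidean R d => tnth x i) @^-1` A i)).
  apply: fin_bigcap_measurable => // i _.
  by rewrite -[X in measurable X]setTI; exact: measurable_tnth.
by apply/seteqP; split=> x /= Ax i; [move=> _|]; exact: Ax.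
Qed.

(** The factors are exchanged one at a time, the others being at most 1. *)
Lemma norm_prodB_le (R : numDomainType) (I : finType) (f g : I -> R) (e : R) :
  (forall i, 0 <= f i <= 1) -> (forall i, 0 <= g i <= 1) ->
  (forall i, `|f i - g i| <= e) ->
  `|\prod_i f i - \prod_i g i| <= e *+ #|I|.
Proof.
move=> f01 g01 fg; rewrite cardE -!big_enum /=; elim: (enum I) => [|i r IH].
  by rewrite !big_nil subrr normr0.
rewrite !big_cons /= mulrS.
set F := \prod_(j <- r) f j in IH *; set G := \prod_(j <- r) g j in IH *.
have -> : f i * F - g i * G = (f i - g i) * F + g i * (F - G) by ring.
have /andP[g0 g1] := g01 i.
have F0 : 0 <= F by apply: prodr_ge0 => j _; have /andP[] := f01 j.
have F1 : F <= 1 by apply: prodr_ile1.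
apply: le_trans (ler_normD _ _) _; rewrite !normrM lerD //.
  by rewrite -[leRHS]mulr1 ler_pM ?normr_ge0 // ger0_norm.
by rewrite -[leRHS]mul1r ler_pM ?normr_ge0 // ger0_norm.
Qed.

(** * The discrepancy on the cells *)

Section PointSet.
Variables (R : realType) (b d s n : nat).
Hypothesis b_pr : prime b.
Variable C : 'I_d -> 'M['F_b]_(s, n).
Local Notation word := 'cV['F_b]_s.
Local Notation words := {ffun 'I_d -> 'cV['F_b]_s}.
Local Notation B := (b%:R : R).

Let b_gt0 : 0 < B. Proof. by rewrite ltr0n prime_gt0. Qed.
Let bX_gt0 k : 0 < B ^+ k. Proof. by rewrite exprn_gt0. Qed.

Lemma tnth_digital_net nu i : tnth (digital_net R C nu) i =
  (prefix_value (net_words C (digit_vector b n nu) i) s)%:R / B ^+ s.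
Proof.
rewrite tnth_mktuple -prefix_value_expansion //.
by apply: eq_bigr => k _; rewrite digit_ord ffunE.
Qed.

(* Closed cells overlap, which is harmless for an upper bound. *)
Definition cell (m : words) : set (euclidean R d) :=
  [set x | forall i, tnth x i \in `[(prefix_value (m i) s)%:R / B ^+ s,
                                    (prefix_value (m i) s).+1%:R / B ^+ s]].

Lemma measurable_cell m : measurable (cell m).
Proof.
exact: (@measurable_euclidean_box R d (fun i => [set` `[(prefix_value (m i) s)%:R / B ^+ s,
  (prefix_value (m i) s).+1%:R / B ^+ s]])).
Qed.

Lemma lebesgue_cell m : lebesgue_euclidean R d (cell m) = ((B ^+ s) ^+ d)^-1%:E.
Proof.
rewrite (lebesgue_euclidean_box (A := fun i => [set` `[(prefix_value (m i) s)%:R / B ^+ s,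
  (prefix_value (m i) s).+1%:R / B ^+ s]])) //.
under eq_bigr => i _.
  rewrite lebesgue_measure_itv /= lte_fin ltr_pM2r ?invr_gt0 // ltr_nat ltnSn.
  rewrite -EFinB -mulrBl -natrB // subSnn div1r.
  over.
by rewrite prodEFin prodr_const card_ord exprVn.
Qed.

(** The value of [m] is one less than the least natural number above [x * B ^+ s]. The strict
    inequality on the left matches the half-open anchored box. *)
Lemma word_of_real (x : R) : 0 < x <= 1 -> exists m : word,
  (prefix_value m s)%:R < x * B ^+ s <= (prefix_value m s).+1%:R.
Proof.
move=> /andP[x0 x1]; set y := x * B ^+ s.
have y0 : 0 < y by rewrite mulr_gt0.
have exN : exists N, y <= N%:R.
  by exists (b ^ s)%N; rewrite natrX -[leRHS]mul1r ler_wpM2r // ltW.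
case: (ex_minnP exN) => -[|q] yq qmin; first by have := lt_le_trans y0 yq; rewrite ltxx.
have qs : (q < b ^ s)%N.
  by apply: qmin; rewrite natrX -[leRHS]mul1r ler_wpM2r // ltW.
have [m mq] := word_of_nat b_pr qs.
exists m; rewrite mq yq andbT ltNge; apply/negP => /qmin.
by rewrite ltnn.
Qed.

Lemma belowE (m z : words) : below R m z =
  [forall i, (prefix_value (z i) s <= prefix_value (m i) s)%N]%:R.
Proof.
case: forallP => [H|/forallP]; first by rewrite /below big1 // => i _; rewrite H.
rewrite negb_forall => /existsP[i /negbTE Hi].
by rewrite /below (bigD1 i) //= Hi mul0r.
Qed.

(** The points of the net are multiples of [b ^- s], and for [q < y <= q + 1] a natural number is
    below [y] exactly when it is at most [q]. Hence the strict comparison in the box becomes the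
    large one of [below]. *)
Lemma discrepancy_cell (x : euclidean R d) : (forall i, 0 < tnth x i <= 1) ->
  exists2 m, cell m x &
    discrepancy (digital_net R C) x = net_mean C (below R m) - \prod_(i < d) tnth x i.
Proof.
move=> x01; have [f fP] := fin_all_exists (fun i => word_of_real (x01 i)).
exists [ffun i => f i].
  move=> i; rewrite ffunE in_itv /= ler_pdivrMr // ler_pdivlMr //.
  by have /andP[/ltW-> ->] := fP i.
congr (_ - _); rewrite /net_mean mulrC natrX; congr (_ / _).
rewrite -(sum_digit_vector _ b_pr); apply: eq_bigr => nu _.
rewrite belowE indicE; congr (nat_of_bool _)%:R.
apply/idP/forallP => [|H]; rewrite inE /anchored_box /=.
  move=> H i; have /andP[_] := H i; rewrite tnth_digital_net ltr_pdivrMr //.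
  rewrite [X in (_ <= prefix_value X _)%N]ffunE.
  have /andP[_ h1] := fP i => h2; rewrite -ltnS -(ltr_nat R).
  exact: lt_le_trans h1.
move=> i; rewrite tnth_digital_net divr_ge0 ?(ltW (bX_gt0 _)) //= ltr_pdivrMr //.
have /andP[h1 _] := fP i; apply: le_lt_trans h1.
by rewrite ler_nat; have := H i; rewrite [X in (_ <= prefix_value X _)%N]ffunE.
Qed.

(** From [(p + q) ^+ 2 <= 2 * p ^+ 2 + 2 * q ^+ 2]. The second term allows for the volume of
    [[0, x)], which on the cell differs by at most [d%:R / B ^+ s] from its value
    [uniform_mean (below R m)] at the upper corner. *)
Definition cell_bound (m : words) : R :=
  2 * (net_mean C (below R m) - uniform_mean (below R m)) ^+ 2 +
  2 * (d%:R / B ^+ s) ^+ 2.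

Lemma cell_bound_ge0 m : 0 <= cell_bound m.
Proof. by rewrite addr_ge0 // mulr_ge0 // sqr_ge0. Qed.

Lemma sqr_discrepancy_le (x : euclidean R d) : (0 < d)%N -> unit_cube x ->
  discrepancy (digital_net R C) x ^+ 2 <= \sum_m cell_bound m * \1_(cell m) x.
Proof.
move=> d0 x01.
have sum0 : 0 <= \sum_m cell_bound m * \1_(cell m) x.
  by apply: sumr_ge0 => m _; rewrite mulr_ge0 ?cell_bound_ge0.
(* If a coordinate of [x] is 0, the anchored box is empty and has volume 0, so the discrepancy
   vanishes. Such points are not covered by [discrepancy_cell]. *)
have [/existsP[i /eqP xi0]|/existsPn xn0] := boolP [exists i, tnth x i == 0].
  rewrite /discrepancy (bigD1 i) //= xi0 mul0r subr0 big1 ?mulr0 ?expr0n //.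
  move=> nu _; rewrite indicE memNset // => /(_ i); rewrite xi0.
  by move=> /andP[h1 h2]; have := le_lt_trans h1 h2; rewrite ltxx.
have [|m mx ->] := @discrepancy_cell x.
  by move=> i; have /andP[h1 h2] := x01 i; rewrite lt_neqAle eq_sym xn0 h1 ltW.
apply: (@le_trans _ _ (cell_bound m)); last first.
  rewrite (bigD1 m) //= indicE mem_set // mulr1 lerDl.
  by apply: sumr_ge0 => k _; rewrite mulr_ge0 ?cell_bound_ge0.
have : `|uniform_mean (below R m) - \prod_(i < d) tnth x i| <= d%:R / B ^+ s.
  rewrite uniform_mean_below // [leRHS](_ : _ = B ^- s *+ #|'I_d|); last first.
    by rewrite card_ord mulrC mulr_natr.
  apply: norm_prodB_le => i.
  - rewrite divr_ge0 ?(ltW (bX_gt0 _)) //= ler_pdivrMr // mul1r -natrX ler_nat.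
    exact: prefix_value_lt.
  - by have /andP[-> /ltW] := x01 i.
  - have := mx i; rewrite in_itv /= => /andP[h1 h2].
    rewrite ger0_norm ?subr_ge0 // lerBlDr; apply: le_trans (lerD (lexx _) h1).
    by rewrite -natr1 mulrDl mul1r addrC.
rewrite /cell_bound; set u := uniform_mean _; set w := net_mean _ _.
set p := \prod_(i < d) _; set e := _ / _ => he.
have e0 : 0 <= e by exact: le_trans he.
have : (u - p) ^+ 2 <= e ^+ 2 by rewrite -[leLHS]real_normK ?num_real // lerXn2r ?nnegrE.
have := sqr_ge0 ((w - u) - (u - p)).
nra.
Qed.

(** All cells have measure [(B ^+ s) ^- d], so the integral of the sum over the cells is the uniform
    mean of [cell_bound]. *)
Lemma L2norm_discrepancy_le : (0 < d)%N ->
  (L2norm_cube (discrepancy (digital_net R C)) <=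
     (uniform_mean cell_bound `^ 2^-1)%:E)%E.
Proof.
move=> d0; rewrite /L2norm_cube unlock.
have I_le : (\int[lebesgue_euclidean R d]_x
    (`|((EFin \o discrepancy (digital_net R C)) \_ (@unit_cube R d)) x| `^ 2) <=
    (uniform_mean cell_bound)%:E)%E.
  apply: (@le_trans _ _ (\int[lebesgue_euclidean R d]_x
      \sum_m (cell_bound m * \1_(cell m) x)%:E)%E).
    apply: ge0_le_integralT => x; first exact: poweR_ge0.
    rewrite sumEFin patchE; case: ifPn => [|_].
      rewrite inE /= => x01.
      by rewrite lee_fin powR_mulrn // real_normK ?num_real // sqr_discrepancy_le.
    rewrite abse0 poweR0r ?pnatr_eq0 // lee_fin.
    by apply: sumr_ge0 => m _; rewrite mulr_ge0 ?cell_bound_ge0.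
  rewrite integral_sum_indic; [|exact: cell_bound_ge0|exact: measurable_cell].
  under eq_bigr do rewrite [X in (_ * X)%E]lebesgue_cell -EFinM.
  by rewrite sumEFin -mulr_suml.
rewrite -poweR_EFin; apply: gt0_ler_poweR I_le; first by rewrite invr_ge0.
  by rewrite in_itv /= leey andbT; apply: integral_ge0 => x _; exact: poweR_ge0.
rewrite in_itv /= leey andbT lee_fin divr_ge0 ?exprn_ge0 ?(ltW (bX_gt0 _)) //.
by apply: sumr_ge0 => m _; exact: cell_bound_ge0.
Qed.

Lemma uniform_mean_cell_bound : uniform_mean cell_bound =
  2 * uniform_mean (fun m => (net_mean C (below R m) - uniform_mean (below R m)) ^+ 2) +
  2 * (d%:R / B ^+ s) ^+ 2.
Proof. by rewrite /cell_bound uniform_meanD uniform_meanZ uniform_mean_cst. Qed.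

End PointSet.

Theorem theorem1p1 (R : realType) (d b v : nat) :
  (1 <= d)%N -> prime b ->
  exists2 K : R, 0 < K &
    forall n : nat, (0 < n)%N ->
    forall (s : nat) (C : 'I_d -> 'M['F_b]_(s, n)),
      order_digital_net 2 v C ->
      (L2norm_cube (discrepancy (digital_net R C)) <=
         (K * (n%:R `^ ((d%:R - 1) / 2) / b%:R ^+ n))%:E)%E.
Proof.
case: d => // d _ b_pr.
have [c c0 cP] := uniform_mean_sqr_net_discrepancy R d v b_pr.
(* The factor [2 ^+ d] comes from [n.+1 <= 2 * n]. The second term bounds the error on the cells, of
   order [b ^- s <= b ^- n]. *)
pose K2 : R := 2 * (c * 2 ^+ d) + 2 * d.+1%:R ^+ 2.
have K2_gt0 : 0 < K2.
  by rewrite ltr_wpDl ?mulr_ge0 ?exprn_ge0 // mulr_gt0 // exprn_gt0.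
exists (K2 `^ 2^-1); first exact: powR_gt0.
move=> n n_gt0 s C [ns _ C_net].
have B_gt0 k : 0 < b%:R ^+ k :> R by rewrite exprn_gt0 // ltr0n prime_gt0.
have n_le_s : (n <= s)%N by rewrite (leq_trans _ ns) // mul2n -addnn leq_addr.
apply: le_trans (L2norm_discrepancy_le R b_pr C _) _ => //; rewrite lee_fin.
(* The bound is written as a square root, to be compared with that of [L2norm_discrepancy_le]. *)
have -> : K2 `^ 2^-1 * (n%:R `^ ((d.+1%:R - 1) / 2) / b%:R ^+ n) =
    (K2 * n%:R ^+ d / (b%:R ^+ n) ^+ 2) `^ 2^-1.
  rewrite !powRM ?mulr_ge0 ?invr_ge0 ?exprn_ge0 ?(ltW K2_gt0) ?(ltW (B_gt0 _)) //.
  rewrite -mulrA (_ : d.+1%:R - 1 = d%:R :> R); last by rewrite -natr1 addrK.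
  rewrite powRrM powR_mulrn //; congr (_ * (_ * _)).
  rewrite (_ : (b%:R ^+ n) ^- 2 = ((b%:R ^+ n)^-1) ^+ 2); last by rewrite exprVn.
  by rewrite powR12_sqrt ?sqr_ge0 // sqrtr_sqr ger0_norm // invr_ge0 ltW.
have m0 : 0 <= uniform_mean (cell_bound R C).
  by rewrite divr_ge0 ?exprn_ge0 ?(ltW (B_gt0 _)) // sumr_ge0 // => m _; exact: cell_bound_ge0.
apply: ge0_ler_powR; rewrite ?nnegrE ?invr_ge0 //.
  by rewrite divr_ge0 ?mulr_ge0 ?exprn_ge0 ?(ltW K2_gt0) ?(ltW (B_gt0 _)).
rewrite uniform_mean_cell_bound // /K2 [_ * n%:R ^+ d]mulrDl [leRHS]mulrDl lerD //.
  rewrite -!mulrA ler_pM2l // -exprM mulnC.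
  apply: le_trans (cP s n C C_net) _.
  rewrite -!mulrA ler_wpM2l // mulrA ler_pM2r ?invr_gt0 // -exprMn lerXn2r ?nnegrE //.
  by rewrite -natrM ler_nat; lia.
rewrite -[leRHS]mulrA -[leRHS]mulrA ler_pM2l // expr_div_n ler_wpM2l ?sqr_ge0 //.
rewrite -[leLHS]mul1r ler_pM ?invr_ge0 ?exprn_ge0 ?(ltW (B_gt0 _)) //.
  by rewrite exprn_ege1 // (ler_nat _ 1).
rewrite lef_pV2 ?posrE ?exprn_gt0 ?ltr0n ?prime_gt0 //.
by rewrite lerXn2r ?nnegrE ?(ltW (B_gt0 _)) // ler_weXn2l // (ler_nat _ 1) prime_gt0.
Qed.
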